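(* Let $n\ge2$ and let $f$ be a binary $n$-ic form with integer coefficients. The class of $I_f^{n-2}$ is the class of the inverse different of $R_f$. In other words, as $R_f$-modules, $I_f^{n-2}\cong\operatorname{Hom}_{\mathbb{Z}}(R_f,\mathbb{Z})$. (For $f\equiv0$, $R_f$ and $I_f^{n-2}$ are understood as the ring $\mathcal{R}_f$ and the module $\mathcal{I}_{f,n-2}$ defined by the universal multiplication and action tables.)
   Context: A binary $n$-ic form is $f=f_0x^n+f_1x^{n-1}y+\dots+f_ny^n$ with $f_i\in\mathbb{Z}$. If $f_0\neq0$: $Q_f=\mathbb{Q}[\theta]/(f_0\theta^n+\dots+f_n)$, $\zeta_0=1$, $\zeta_k=f_0\theta^k+f_1\theta^{k-1}+\dots+f_{k-1}\theta$ for $1\le k\le n-1$; $R_f$ is the subring of $Q_f$ with $\mathbb{Z}$-basis $\zeta_0,\dots,\zeta_{n-1}$; $I_f=(1,\theta)$ is the $R_f$-submodule of $Q_f$ generated by $1,\theta$, and $I_f^k$ is its $k$-th power as a fractional ideal ($I_f^0=R_f$). If $f\neq0$ but $f_0=0$, replace $f$ by a $GL_2(\mathbb{Z})$-transform (linear substitution) with nonzero $x^n$-coefficient; $R_f$ and the class of $I_f^k$ do not depend on the choice. Universal tables: let $A=\mathbb{Z}[f_0,\dots,f_n]$ with the $f_i$ indeterminates and make the same construction over $A$ inside $\operatorname{Frac}(A)[\theta]/(f_0\theta^n+\dots+f_n)$. The universal ring has $A$-basis $\zeta_0,\dots,\zeta_{n-1}$ and, for $0\le k\le n-1$, the universal $I^k$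 has $A$-basis $1,\theta,\dots,\theta^k,\zeta_{k+1},\dots,\zeta_{n-1}$. The structure constants of multiplication and of the action in these bases are polynomials in the $f_i$ with integer coefficients. Specializing the $f_i$ to the coefficients of any form $f$ over $\mathbb{Z}$ (including $f\equiv0$) defines a ring $\mathcal{R}_f$, free of rank $n$ over $\mathbb{Z}$, and $\mathcal{R}_f$-modules $\mathcal{I}_{f,k}$; for $f\ne0$ these agree with $R_f$ and $I_f^k$. The inverse different of a ring $R$ free of finite rank over $\mathbb Z$ is the $R$-module $\operatorname{Hom}_{\mathbb{Z}}(R,\mathbb{Z})$, with $(r\phi)(s)=\phi(rs)$. *)

(* Defs.v *)
From HB Require Import structures.
From mathcomp Require Import all_boot all_order all_algebra.
From mathcomp Require Import boolp functions.
From mathcomp Require Import mpoly.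

Set Implicit Arguments.
Unset Strict Implicit.
Unset Printing Implicit Defensive.

Import Order.TTheory GRing.Theory Num.Theory.
Local Open Scope ring_scope.

(* A binary n-ic form f_0 x^n + f_1 x^(n-1) y + ... + f_n y^n over D is the   *)
(* row vector of its coefficients, of type 'rV[D]_n.+1.                       *)

(* f_i, extended by 0 for i > n; rVpoly f is the dehomogenization f(1, X).    *)
Definition fcoef (D : nzRingType) (n : nat) (f : 'rV[D]_n.+1) (i : nat) : D :=
  (rVpoly f)`_i.

(* f(a x + b y, c x + d y) for g = [[a, b], [c, d]]; the coefficient of       *)
(* x^(n-k) y^k is read off at X^k after setting x = 1 and y = X.              *)
Definition form_subst (D : comNzRingType) (n : nat) (g : 'M[D]_2)
    (f : 'rV[D]_n.+1) : 'rV[D]_n.+1 :=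
  \row_(k < n.+1)
    (\sum_(i < n.+1) f 0 i *:
       (((g 0 0)%:P + (g 0 1) *: 'X) ^+ (n - i)
        * ((g 1 0)%:P + (g 1 1) *: 'X) ^+ i))`_k.

Lemma form_subst_lead (n : nat) (f : 'rV[int]_n.+1) : f != 0 ->
  exists2 g : 'M[int]_2, g \in unitmx & form_subst g f 0 0 != 0.
Proof.
move=> f0; have p0 : rVpoly f != 0.
  by apply: contra f0 => /eqP/(congr1 (@poly_rV _ n.+1)); rewrite rVpolyK raddf0 => ->.
have [t pt] : exists t : int, ~~ root (rVpoly f) t.
  pose s : seq int := [seq Posz i | i <- iota 0 (size (rVpoly f))].
  have us : uniq s by rewrite map_inj_uniq ?iota_uniq // => i j [].
  have /allPn[t _ ht] : ~~ all (root (rVpoly f)) s; last by exists t.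
  apply/negP => /(max_poly_roots p0)/(_ us).
  by rewrite size_map size_iota ltnn.
exists (\matrix_(i < 2, j < 2)
  (if i == 0 then (j == 0)%:R else if j == 0 then t else 1)).
  by rewrite unitmxE (expand_det_row _ ord0) !big_ord_recl big_ord0 /cofactor !det_mx11 !mxE /=
    ?(mul1r,mul0r,addr0,expr0).
rewrite mxE -horner_coef0 horner_sum.
move: pt; rewrite /root; congr (_ != 0).
rewrite (horner_coef_wide _ (size_poly _ _)); apply: eq_bigr => i _.
rewrite coef_rVpoly_ord !mxE /= !hornerE expr1n.
by congr (_ * _); rewrite [RHS]mulr1.
Qed.

Section OverDomain.

Variables (D : idomainType) (K : fieldType) (iota : {rmorphism D -> K}).
Variables (n : nat) (f : 'rV[D]_n.+1).

(* {poly %/ p} is the quotient K[X]/(p) only for p monic of positive degree,  *)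
(* whence the division by f_0.                                                *)
Definition form_mod : {poly K} :=
  (iota (f 0 0))^-1 *: \sum_(i < n.+1) iota (f 0 i) *: 'X^(n - i).

Definition Qalg : Type := {poly %/ form_mod}.
HB.instance Definition _ := GRing.ComAlgebra.on Qalg.

Definition theta : Qalg := 'qX.

(* Meaningful for every k, although the basis only uses k < n.                *)
Definition zeta (k : nat) : Qalg :=
  if k is 0 then 1
  else \sum_(i < k) iota (fcoef f i) *: theta ^+ (k - i).

(* 1, theta, ..., theta^k, zeta_(k+1), ..., zeta_(n-1)                        *)
Definition powbasis (k : nat) (j : nat) : Qalg :=
  if (j <= k)%N then theta ^+ j else zeta j.

Definition comb (b : nat -> Qalg) (a : 'rV[D]_n) : Qalg :=
  \sum_(i < n) iota (a 0 i) *: b i.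

Lemma comb_is_additive b : zmod_morphism (comb b).
Proof.
move=> x y; rewrite /comb -sumrB; apply: eq_bigr => i _.
by rewrite !mxE rmorphB scalerBl.
Qed.
HB.instance Definition _ b :=
  GRing.isZmodMorphism.Build 'rV[D]_n Qalg (comb b) (comb_is_additive b).

Lemma combZ b d a : comb b (d *: a) = iota d *: comb b a.
Proof.
rewrite /comb scaler_sumr; apply: eq_bigr => i _.
by rewrite !mxE rmorphM scalerA.
Qed.

Lemma comb_delta b (i : 'I_n) : comb b (delta_mx 0 i) = b i.
Proof.
rewrite /comb (bigD1 i) //= big1 => [|j ji].
  by rewrite mxE !eqxx rmorph1 scale1r addr0.
by rewrite mxE (negPf ji) andbF rmorph0 scale0r.
Qed.

Hypothesis (hn : (1 < n)%N) (h0 : iota (f 0 0) != 0).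

Lemma form_modE : exists2 r : {poly K},
  form_mod = 'X^n + r & (size r < size ('X^n : {poly K}))%N.
Proof.
exists ((iota (f 0 0))^-1 *:
  \sum_(i < n) iota (f 0 (lift ord0 i)) *: 'X^(n - (lift ord0 i))).
  rewrite /form_mod big_ord_recl /= subn0 scalerDr scalerA mulVf // scale1r.
  by [].
rewrite size_polyXn ltnS; apply: leq_trans (size_scale_leq _ _) _.
apply: (leq_trans (size_sum _ _ _)); apply/bigmax_leqP => i _.
apply: leq_trans (size_scale_leq _ _) _; rewrite size_polyXn /= /bump /= add1n.
by rewrite ltn_subrL /= (ltnW hn).
Qed.

Lemma form_mod_monic : form_mod \is monic.
Proof.
case: form_modE => r -> sr.
by rewrite monicE lead_coefDl // lead_coefXn.
Qed.

Lemma size_form_mod : size form_mod = n.+1.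
Proof. by case: form_modE => r -> sr; rewrite size_polyDl // size_polyXn. Qed.

Lemma mk_form_mod : mk_monic form_mod = form_mod.
Proof. by rewrite /mk_monic size_form_mod form_mod_monic ltnS ltnW. Qed.

Lemma thetaX j : theta ^+ j = in_qpoly form_mod 'X^j.
Proof. by rewrite rmorphXn. Qed.

Lemma theta_root :
  \sum_(i < n.+1) iota (f 0 i) *: theta ^+ (n - i) = 0 :> Qalg.
Proof.
suff: in_qpoly form_mod
        (\sum_(i < n.+1) iota (f 0 i) *: 'X^(n - i)) = 0.
  move=> e0; rewrite -[RHS]e0 raddf_sum; apply: eq_bigr => i _.
  by rewrite thetaX; exact/esym/in_qpolyZ.
have -> : \sum_(i < n.+1) iota (f 0 i) *: 'X^(n - i) =
   iota (f 0 0) *: form_mod.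
  by rewrite /form_mod scalerA mulfV // scale1r.
rewrite in_qpolyZ; suff -> : in_qpoly form_mod form_mod = 0 by rewrite scaler0.
by apply: val_inj; rewrite /= mk_form_mod Pdiv.RingMonic.rmodpp // form_mod_monic.
Qed.

Lemma fcoefE (i : 'I_n.+1) : fcoef f i = f 0 i.
Proof. by rewrite /fcoef coef_rVpoly_ord. Qed.

Lemma fcoef_big i : (n < i)%N -> fcoef f i = 0.
Proof.
by move=> ni; rewrite /fcoef nth_default // (leq_trans (size_poly _ _)).
Qed.

Let Z (m : nat) : Qalg := \sum_(i < m) iota (fcoef f i) *: theta ^+ (m - i).

Let zetaZ m : (0 < m)%N -> zeta m = Z m. Proof. by case: m. Qed.

Let Zn1 m : Z (n.+1 + m) = 0.
Proof.
rewrite /Z big_split_ord /= [X in _ + X]big1 => [|i _]; last first.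
  by rewrite fcoef_big ?rmorph0 ?scale0r // leq_addr.
have /(congr1 ( *%R (theta ^+ m.+1))) := theta_root; rewrite mulr0 => e0.
rewrite addr0 -[RHS]e0 mulr_sumr.
apply: eq_bigr => i _; rewrite -scalerAr -exprD fcoefE; congr (_ *: _ ^+ _).
have := ltn_ord i; rewrite ltnS => hi.
by rewrite addnBA // addSnnS addnC.
Qed.

Let Zn : Z n = - (iota (fcoef f n) *: 1).
Proof.
apply/eqP; rewrite -addr_eq0.
rewrite -[X in _ == X]theta_root big_ord_recr /= subnn expr0.
rewrite -fcoefE; apply/eqP; congr (_ + _); apply: eq_bigr => i _.
by rewrite -fcoefE.
Qed.

Let Zshift i j :
  Z i * theta ^+ j = Z (i + j) -
    \sum_(t < j) iota (fcoef f (i + t)) *: theta ^+ (j - t).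
Proof.
apply/eqP; rewrite eq_sym subr_eq; apply/eqP.
rewrite /Z big_split_ord /= mulr_suml; congr (_ + _); apply: eq_bigr => t _.
  rewrite -scalerAl -exprD; congr (_ *: _ ^+ _).
  by rewrite addnBAC // ltnW.
by rewrite subnDl.
Qed.

Let spn b x := exists a, x = comb b a.

Let spnB b x y : spn b x -> spn b y -> spn b (x - y).
Proof. by move=> [u ->] [v ->]; exists (u - v); rewrite raddfB. Qed.

Let spnD b x y : spn b x -> spn b y -> spn b (x + y).
Proof. by move=> [u ->] [v ->]; exists (u + v); rewrite raddfD. Qed.

Let spnZ b d x : spn b x -> spn b (iota d *: x).
Proof. by move=> [u ->]; exists (d *: u); rewrite combZ. Qed.

Let spn_sum b (I : finType) (F : I -> Qalg) :
  (forall i, spn b (F i)) -> spn b (\sum_i F i).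
Proof.
move=> hF; elim/big_rec: _ => [|i x _ hx]; first by exists 0; rewrite raddf0.
exact: spnD.
Qed.

Let spnb b i : (i < n)%N -> spn b (b i).
Proof. by move=> hi; exists (delta_mx 0 (Ordinal hi)); rewrite comb_delta. Qed.

Let spn_theta k j : (j <= k)%N -> (j < n)%N -> spn (powbasis k) (theta ^+ j).
Proof. by move=> jk jn; have := spnb (powbasis k) jn; rewrite /powbasis jk. Qed.

Let spn_Z k m : spn (powbasis k) (Z m).
Proof.
have n0 : (0 < n)%N by exact: ltnW.
have [mn|] := ltnP m n; last first.
  rewrite leq_eqVlt => /orP[/eqP <-|/subnKC <-]; last first.
    by rewrite Zn1; exists 0; rewrite raddf0.
  rewrite Zn -scalerN -[- 1]sub0r; apply: spnZ; apply: spnB.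
    by exists 0; rewrite raddf0.
  exact: (@spn_theta k 0).
have [mk|km] := leqP m k; last first.
  have := spnb (powbasis k) mn; rewrite /powbasis leqNgt km /= zetaZ //.
  exact: leq_ltn_trans km.
apply: spn_sum => i; apply: spnZ; apply: spn_theta.
  exact: leq_trans (leq_subr _ _) mk.
exact: leq_ltn_trans (leq_subr _ _) mn.
Qed.

Lemma zeta_powbasis k i j : (i < n)%N -> (j < n)%N ->
  exists a, zeta i * powbasis k j = comb (powbasis k) a.
Proof.
move=> hi hj; case: i hi => [_|i hi]; first by rewrite mul1r; exact: spnb.
rewrite zetaZ // {1}/powbasis; case: leqP => [jk|kj].
  rewrite Zshift; apply: spnB; first exact: spn_Z.
  apply: spn_sum => t; apply: spnZ; apply: spn_theta.
    exact: leq_trans (leq_subr _ _) jk.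
  exact: leq_ltn_trans (leq_subr _ _) hj.
rewrite zetaZ ?(leq_ltn_trans _ kj) //.
suff -> : Z i.+1 * Z j = \sum_(s < j) (iota (fcoef f s) *: Z (i.+1 + (j - s))
            - iota (fcoef f (i.+1 + s)) *: Z (j - s)).
  by apply: spn_sum => s; apply: spnB; apply: spnZ; apply: spn_Z.
rewrite {2}/Z mulr_sumr sumrB.
rewrite (eq_bigr (fun s : 'I_j => iota (fcoef f s) *: Z (i.+1 + (j - s)) -
   \sum_(t < j | (s + t < j)%N) iota (fcoef f s) *:
       (iota (fcoef f (i.+1 + t)) *: theta ^+ (j - (s + t))))); last first.
  move=> s _; rewrite -scalerAr Zshift scalerBr; congr (_ - _).
  rewrite scaler_sumr (big_ord_widen_cond j xpredT
    (fun t => iota (fcoef f s) *: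
       (iota (fcoef f (i.+1 + t)) *: theta ^+ (j - s - t)))) ?leq_subr //=.
  by apply: eq_big => [t|t _]; rewrite ?ltn_subRL ?subnDA.
rewrite sumrB; congr (_ - _); rewrite (exchange_big_dep xpredT) //=.
apply: eq_bigr => t _; rewrite /Z scaler_sumr.
rewrite [RHS](big_ord_widen_cond j xpredT
    (fun s => iota (fcoef f (i.+1 + t)) *:
       (iota (fcoef f s) *: theta ^+ (j - t - s)))) ?leq_subr //=.
apply: eq_big => [s|s _]; first by rewrite ltn_subRL addnC.
by rewrite !scalerA mulrC subnDA subnAC.
Qed.

Lemma powbasis0 j : powbasis 0 j = zeta j.
Proof. by case: j. Qed.

Lemma zeta_zeta i j : (i < n)%N -> (j < n)%N ->
  exists a, zeta i * zeta j = comb zeta a.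
Proof.
move=> hi hj; have [a] := @zeta_powbasis 0 i j hi hj.
rewrite powbasis0 => ->; exists a; apply: eq_bigr => l _.
by rewrite powbasis0.
Qed.

Lemma comb_zetaM a b : exists c, comb zeta a * comb zeta b = comb zeta c.
Proof.
rewrite /comb mulr_suml; apply: spn_sum => i; rewrite mulr_sumr.
apply: spn_sum => j; rewrite -scalerAl -scalerAr; do 2!apply: spnZ.
exact: zeta_zeta.
Qed.

Lemma comb_zeta1 : exists c, 1 = comb zeta c.
Proof. by have := @spnb zeta 0 (ltnW hn). Qed.

Lemma val_theta j : (j < n)%N -> theta ^+ j = 'X^j :> {poly K}.
Proof.
move=> jn; rewrite thetaX in_qpoly_small // mk_form_mod size_form_mod.
by rewrite size_polyXn ltnS.
Qed.

Lemma size_powbasis k j : (j < n)%N -> size (powbasis k j : {poly K}) = j.+1.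
Proof.
move=> jn; rewrite /powbasis; case: leqP => [_|kj].
  by rewrite val_theta // size_polyXn.
have j0 := leq_ltn_trans (leq0n _) kj.
rewrite zetaZ // /Z; case: j jn kj j0 => // j jn _ _.
rewrite big_ord_recl subn0.
rewrite (_ : fcoef f (@ord0 j) = f 0 0); last exact: (fcoefE ord0).
have -> (x y : Qalg) : (x + y : {poly K}) = (x : {poly K}) + (y : {poly K}).
  by [].
rewrite poly_of_qpolyZ val_theta // size_polyDl size_scale ?size_polyXn //.
rewrite poly_of_qpoly_sum ltnS; apply: (leq_trans (size_sum _ _ _)).
apply/bigmax_leqP => i _.
rewrite poly_of_qpolyZ; apply: leq_trans (size_scale_leq _ _) _.
rewrite val_theta; last exact: leq_ltn_trans (leq_subr _ _) jn.
by rewrite size_polyXn /= /bump /= add1n ltnS subSS leq_subr.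
Qed.

Hypothesis iota_inj : injective iota.

Lemma comb_powbasis_inj k : injective (comb (powbasis k)).
Proof.
apply: raddf_inj => a a0; apply/rowP => i; rewrite mxE; apply: iota_inj.
rewrite rmorph0; apply/eqP; apply: contraTT isT => ai /=.
pose P (i : 'I_n) := iota (a 0 i) != 0.
case: (@arg_maxnP _ i P (fun i => nat_of_ord i) ai) => {i ai} i ai imax.
have := congr1 (fun x : Qalg => (x : {poly K})`_i) a0.
rewrite /comb poly_of_qpoly_sum coef_sum coef0 (bigD1 i) //= big1 => [|j ji].
  rewrite addr0 coefZ => /eqP; rewrite mulf_eq0 (negPf ai) /=.
  have := size_powbasis k (ltn_ord i) => sb.
  rewrite -[i in _`_i]/(i.+1.-1) -sb -lead_coefE lead_coef_eq0.
  by rewrite -size_poly_eq0 sb.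
rewrite coefZ; have [Pj|/negPn/eqP ->] := boolP (P j); last by rewrite mul0r.
rewrite nth_default ?mulr0 // size_powbasis // ltn_neqAle.
by rewrite -val_eqE in ji; rewrite ji; exact: imax.
Qed.

Lemma comb_zeta_inj : injective (comb zeta).
Proof.
have e : comb zeta =1 comb (powbasis 0).
  by move=> a; apply: eq_bigr => l _; rewrite powbasis0.
exact: eq_inj (@comb_powbasis_inj 0) (fsym e).
Qed.

End OverDomain.

(* Hom_Z(R, Z) with (r phi)(s) = phi (r s).                                   *)
Section InverseDifferent.
Variable R : comNzRingType.

Definition additive_pred : {pred R -> int} :=
  fun phi => `[< zmod_morphism phi >].

Lemma additive_pred_zmod : zmod_closed additive_pred.
Proof.
split; first by apply/asboolP => x y; rewrite subrr.
move=> p q /asboolP hp /asboolP hq; apply/asboolP => x y.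
rewrite [LHS]/GRing.add /= /GRing.opp /= hp hq.
by rewrite opprD addrACA -opprD.
Qed.
HB.instance Definition _ :=
  GRing.isZmodClosed.Build (R -> int) additive_pred additive_pred_zmod.

Definition inv_different : Type := {phi : R -> int | phi \in additive_pred}.
HB.instance Definition _ := SubChoice.on inv_different.
HB.instance Definition _ := [SubChoice_isSubZmodule of inv_different by <:].

Lemma inv_different_scale_subproof (r : R) (phi : inv_different) :
  (fun s => \val phi (r * s)) \in additive_pred.
Proof.
by apply/asboolP => x y; rewrite mulrBr; have /asboolP -> := valP phi.
Qed.

Definition inv_different_scale (r : R) (phi : inv_different) : inv_different :=
  Sub (fun s => \val phi (r * s)) (inv_different_scale_subproof r phi).

Let scaleA a b v : inv_different_scale a (inv_different_scale b v) =
  inv_different_scale (a * b) v.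
Proof.
by apply: val_inj; apply: funext => s /=; rewrite mulrA [b * a]mulrC.
Qed.
Let scale1 : left_id 1 inv_different_scale.
Proof. by move=> v; apply: val_inj; apply: funext => s /=; rewrite mul1r. Qed.
Let scaleDr : right_distributive inv_different_scale +%R.
Proof. by move=> a u v; apply: val_inj. Qed.
Let scaleDl v : {morph inv_different_scale^~ v : a b / a + b}.
Proof.
move=> a b; apply: val_inj; apply: funext => s /=; rewrite mulrDl.
have /asboolP hv := valP v; have v0 : \val v 0 = 0 by rewrite -(subrr 0) hv subrr.
by rewrite -{1}[b * s]opprK hv -[- (b * s)]sub0r hv v0 sub0r opprK.
Qed.
HB.instance Definition _ :=
  GRing.Zmodule_isLmodule.Build R inv_different scaleA scale1 scaleDr scaleDl.
End InverseDifferent.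

Section FractionalIdeals.
Variables (n : nat) (f : 'rV[int]_n.+1).

Definition Qf : Type := Qalg (intr : {rmorphism int -> rat}) f.
HB.instance Definition _ := GRing.ComAlgebra.on Qf.

Definition Rf_pred : {pred Qf} :=
  fun x => `[< exists a : 'rV[int]_n, x = comb (zeta intr f) a >].

Definition If_pred : {pred Qf} :=
  fun x => `[< exists r s : Qf,
    [/\ r \in Rf_pred, s \in Rf_pred & x = r + s * theta intr f] >].

Definition ideal_mul (I J : {pred Qf}) : {pred Qf} :=
  fun x => `[< exists2 s : seq (Qf * Qf),
    all (fun p => (p.1 \in I) && (p.2 \in J)) s &
    x = \sum_(p <- s) p.1 * p.2 >].

Fixpoint If_pow_pred (k : nat) : {pred Qf} :=
  if k is k'.+1 then ideal_mul If_pred (If_pow_pred k') else Rf_pred.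
End FractionalIdeals.
Arguments Rf_pred {n} f.
Arguments If_pred {n} f.
Arguments If_pow_pred {n} f.

(* Rf_mem and If_pow_mem keep the proofs hn and h0 as arguments so that the   *)
(* ring and module instances can be attached to these subsets.                *)
Section Order.
Variables (n : nat) (f : 'rV[int]_n.+1).
Variables (hn : (1 < n)%N) (h0 : f 0 0 != 0).

Let h0' : (intr (f 0 0) : rat) != 0. Proof. by rewrite intr_eq0. Qed.

Definition Rf_mem of (1 < n)%N & f 0 0 != 0 : {pred Qf f} := Rf_pred f.

Lemma Rf_subring : subring_closed (Rf_mem hn h0).
Proof.
split.
- apply/asboolP; exact: comb_zeta1.
- move=> x y /asboolP[a ->] /asboolP[b ->]; apply/asboolP; exists (a - b).
  by rewrite raddfB.
- move=> x y /asboolP[a ->] /asboolP[b ->]; apply/asboolP.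
  exact: comb_zetaM.
Qed.
HB.instance Definition _ :=
  GRing.isSubringClosed.Build (Qf f) (Rf_mem hn h0) Rf_subring.

Definition Rf : Type := {x : Qf f | x \in Rf_mem hn h0}.
HB.instance Definition _ := SubChoice.on Rf.
HB.instance Definition _ := [SubChoice_isSubComNzRing of Rf by <:].

Definition If_pow_mem of (1 < n)%N & f 0 0 != 0 : nat -> {pred Qf f} :=
  If_pow_pred f.

Let submod (P : {pred Qf f}) := [/\ 0 \in P,
  {in P &, forall x y, x + y \in P} &
  {in Rf_mem hn h0 & P, forall r x, r * x \in P}].

Let If_submod : submod (If_pred f).
Proof.
split.
- apply/asboolP; exists 0, 0; split; rewrite ?mul0r ?addr0 //;
    exact: (rpred0 (Rf_mem hn h0)).
- move=> x y /asboolP[r [s [hr hs ->]]] /asboolP[r' [s' [hr' hs' ->]]].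
  apply/asboolP; exists (r + r'), (s + s'); split.
  + exact: (@rpredD _ (Rf_mem hn h0)).
  + exact: (@rpredD _ (Rf_mem hn h0)).
  by rewrite mulrDl addrACA.
- move=> t x ht /asboolP[r [s [hr hs ->]]].
  apply/asboolP; exists (t * r), (t * s); split.
  + exact: (@rpredM _ (Rf_mem hn h0)).
  + exact: (@rpredM _ (Rf_mem hn h0)).
  by rewrite mulrDr mulrA.
Qed.

Let If_pow_submod k : submod (If_pow_mem hn h0 k).
Proof.
case: k => [|k].
  split; [exact: (rpred0 (Rf_mem hn h0))|exact: (@rpredD _ (Rf_mem hn h0))|].
  exact: (@rpredM _ (Rf_mem hn h0)).
have [I0 ID IM] := If_submod; split.
- by apply/asboolP; exists [::]; rewrite ?big_nil.
- move=> x y /asboolP[s hs ->] /asboolP[t ht ->]; apply/asboolP.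
  by exists (s ++ t); rewrite ?all_cat ?hs ?big_cat.
- move=> r x hr /asboolP[s hs ->]; apply/asboolP.
  exists [seq (r * p.1, p.2) | p <- s].
    rewrite all_map; apply: sub_all hs => p /= /andP[h1 ->].
    by rewrite IM.
  by rewrite big_map mulr_sumr; apply: eq_bigr => p _; rewrite mulrA.
Qed.

Lemma If_pow_zmod k : zmod_closed (If_pow_mem hn h0 k).
Proof.
have [I0 ID IM] := If_pow_submod k; split=> // x y hx hy.
apply: ID => //; rewrite -mulN1r IM //.
exact: (@rpredN1 _ (Rf_mem hn h0)).
Qed.
HB.instance Definition _ k :=
  GRing.isZmodClosed.Build (Qf f) (If_pow_mem hn h0 k) (If_pow_zmod k).

Definition If_pow (k : nat) : Type := {x : Qf f | x \in If_pow_mem hn h0 k}.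
HB.instance Definition _ k := SubChoice.on (If_pow k).
HB.instance Definition _ k := [SubChoice_isSubZmodule of If_pow k by <:].

Lemma If_pow_scale_subproof k (r : Rf) (x : If_pow k) :
  \val r * \val x \in If_pow_mem hn h0 k.
Proof. by have [_ _ IM] := If_pow_submod k; apply: IM; exact: valP. Qed.

Definition If_pow_scale k (r : Rf) (x : If_pow k) : If_pow k :=
  Sub (\val r * \val x) (If_pow_scale_subproof r x).

Let scaleA k (a b : Rf) (v : If_pow k) :
  If_pow_scale a (If_pow_scale b v) = If_pow_scale (a * b) v.
Proof. by apply: val_inj; rewrite /= mulrA. Qed.
Let scale1 k : left_id 1 (@If_pow_scale k).
Proof. by move=> v; apply: val_inj; rewrite /= mul1r. Qed.
Let scaleDr k : right_distributive (@If_pow_scale k) +%R.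
Proof. by move=> a u v; apply: val_inj; rewrite /= mulrDr. Qed.
Let scaleDl k (v : If_pow k) : {morph (@If_pow_scale k)^~ v : a b / a + b}.
Proof. by move=> a b; apply: val_inj; rewrite /= mulrDl. Qed.
HB.instance Definition _ k := GRing.Zmodule_isLmodule.Build Rf (If_pow k)
  (@scaleA k) (@scale1 k) (@scaleDr k) (@scaleDl k).
End Order.

(* A table t lists the products of basis vectors e_i * b_j = sum_l t i j l b_l *)
(* and extends them bilinearly to coordinate vectors.                          *)
Definition table_mul (D : comNzRingType) (n : nat) (t : 'I_n -> 'M[D]_n)
    (x y : 'rV[D]_n) : 'rV[D]_n :=
  \sum_(i < n) x 0 i *: (y *m t i).

Definition row_one (D : comNzRingType) (n : nat) : 'rV[D]_n :=
  \row_(i < n) (val i == 0%N)%:R.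

Section TableMul.
Variables (D : comNzRingType) (n : nat) (t : 'I_n -> 'M[D]_n).

Lemma table_mulDl : left_distributive (table_mul t) +%R.
Proof.
move=> a b y; rewrite /table_mul -big_split; apply: eq_bigr => i _.
by rewrite mxE scalerDl.
Qed.
Lemma table_mulDr : right_distributive (table_mul t) +%R.
Proof.
move=> a u v; rewrite /table_mul -big_split; apply: eq_bigr => i _.
by rewrite mulmxDl scalerDr.
Qed.
Lemma map_table_mul (E : comNzRingType) (h : {rmorphism D -> E}) x y :
  map_mx h (table_mul t x y) =
  table_mul (fun i => map_mx h (t i)) (map_mx h x) (map_mx h y).
Proof.
rewrite /table_mul raddf_sum; apply: eq_bigr => i _.
by rewrite /= map_mxZ map_mxM mxE.
Qed.
Lemma map_row_one (E : comNzRingType) (h : {rmorphism D -> E}) :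
  map_mx h (row_one D n) = row_one E n.
Proof. by apply/rowP => i; rewrite !mxE rmorph_nat. Qed.
End TableMul.

Section Pullback.
Variables (V W : Type) (Q : comNzRingType) (phi : V -> Q) (psi : W -> Q).
Variables (e : V) (m : V -> V -> V) (a : V -> W -> W).
Hypotheses (phi_inj : injective phi) (psi_inj : injective psi).
Hypotheses (phi1 : phi e = 1) (phiM : forall x y, phi (m x y) = phi x * phi y).
Hypothesis (psiM : forall x y, psi (a x y) = phi x * psi y).

Lemma pullback_mulA : associative m.
Proof. by move=> x y z; apply: phi_inj; rewrite !phiM mulrA. Qed.
Lemma pullback_mulC : commutative m.
Proof. by move=> x y; apply: phi_inj; rewrite !phiM mulrC. Qed.
Lemma pullback_mul1 : left_id e m.
Proof. by move=> x; apply: phi_inj; rewrite phiM phi1 mul1r. Qed.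
Lemma pullback_actA x y z : a x (a y z) = a (m x y) z.
Proof. by apply: psi_inj; rewrite !psiM phiM mulrA. Qed.
Lemma pullback_act1 z : a e z = z.
Proof. by apply: psi_inj; rewrite psiM phi1 mul1r. Qed.
End Pullback.

Section Universal.
Variables (n : nat) (hn : (1 < n)%N).

Notation A := {mpoly int[n.+1]}.
Notation K := {fraction {mpoly int[n.+1]}}.
Notation iota := (@tofrac {mpoly int[n.+1]} : {rmorphism A -> K}).

Definition univ_form : 'rV[A]_n.+1 := \row_i 'X_i.

Let iota_inj : injective iota.
Proof. by move=> x y /eqP; rewrite tofrac_eq => /eqP. Qed.

Let h0 : iota (univ_form 0 0) != 0.
Proof.
rewrite mxE tofrac_eq0; apply/eqP => /(congr1 (mcoeff U_(0))) /eqP.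
by rewrite mcoeffX eqxx mcoeff0.
Qed.

Lemma univ_mul_ex (i j : 'I_n) : exists a : 'rV[A]_n,
  zeta iota univ_form i * zeta iota univ_form j =
  comb (zeta iota univ_form) a.
Proof. exact: zeta_zeta. Qed.

Lemma univ_act_ex (k : nat) (i j : 'I_n) : exists a : 'rV[A]_n,
  zeta iota univ_form i * powbasis iota univ_form k j =
  comb (powbasis iota univ_form k) a.
Proof. exact: zeta_powbasis. Qed.

(* The structure constants of zeta_i * zeta_j, and of zeta_i on the basis of  *)
(* I^k; they are the unique coordinates by comb_zeta_inj, comb_powbasis_inj.  *)
Definition univ_mul (i : 'I_n) : 'M[A]_n :=
  \matrix_(j < n) sval (cid (univ_mul_ex i j)).

Definition univ_act (k : nat) (i : 'I_n) : 'M[A]_n :=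
  \matrix_(j < n) sval (cid (univ_act_ex k i j)).

Lemma comb_univ_mul x y :
  comb (zeta iota univ_form) (table_mul univ_mul x y) =
  comb (zeta iota univ_form) x *
  comb (zeta iota univ_form) y.
Proof.
rewrite /table_mul raddf_sum [in RHS]/comb mulr_suml; apply: eq_bigr => i _.
rewrite /= combZ -scalerAl; congr (_ *: _).
rewrite mulmx_sum_row raddf_sum mulr_sumr.
apply: eq_bigr => j _; rewrite /= combZ -scalerAr rowK; congr (_ *: _).
by case: cid.
Qed.

Lemma comb_univ_act k x y :
  comb (powbasis iota univ_form k)
    (table_mul (univ_act k) x y) =
  comb (zeta iota univ_form) x *
  comb (powbasis iota univ_form k) y.
Proof.
rewrite /table_mul raddf_sum [in RHS]/comb mulr_suml; apply: eq_bigr => i _.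
rewrite /= combZ -scalerAl; congr (_ *: _).
rewrite mulmx_sum_row raddf_sum mulr_sumr.
apply: eq_bigr => j _; rewrite /= combZ -scalerAr rowK; congr (_ *: _).
by case: cid.
Qed.

Lemma comb_row_one :
  comb (zeta iota univ_form) (row_one A n) = 1.
Proof.
have n0 : (0 < n)%N := ltnW hn.
rewrite /comb (bigD1 (Ordinal n0)) //= big1 => [|j /negPf].
  by rewrite mxE rmorph1 scale1r addr0.
by rewrite -val_eqE /= mxE => ->; rewrite rmorph0 scale0r.
Qed.

Let zinj := comb_zeta_inj hn h0 iota_inj.
Let pinj k := @comb_powbasis_inj _ _ _ _ _ hn h0 iota_inj k.

Let univ_mulA := pullback_mulA zinj comb_univ_mul.
Let univ_mulC := pullback_mulC zinj comb_univ_mul.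
Let univ_mul1 := pullback_mul1 zinj comb_row_one comb_univ_mul.
Let univ_actA k := pullback_actA (@pinj k) comb_univ_mul (@comb_univ_act k).
Let univ_act1 k := pullback_act1 (@pinj k) comb_row_one (@comb_univ_act k).

Variable f : 'rV[int]_n.+1.

Definition specialize : {rmorphism A -> int} := meval (fun i => f 0 i).

Definition spec_mul (i : 'I_n) : 'M[int]_n := map_mx specialize (univ_mul i).
Definition spec_act (k : nat) (i : 'I_n) : 'M[int]_n :=
  map_mx specialize (univ_act k i).

Let lft (x : 'rV[int]_n) : 'rV[A]_n := map_mx (@mpolyC n.+1 int) x.
Let lftK x : map_mx specialize (lft x) = x.
Proof. by apply/rowP => i; rewrite !mxE /= mevalC. Qed.
Let mulE x y :
  table_mul spec_mul x y = map_mx specialize (table_mul univ_mul (lft x) (lft y)).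
Proof. by rewrite map_table_mul !lftK. Qed.
Let actE k x y : table_mul (spec_act k) x y =
  map_mx specialize (table_mul (univ_act k) (lft x) (lft y)).
Proof. by rewrite map_table_mul !lftK. Qed.
Let mulE' x y : table_mul spec_mul (map_mx specialize x) (map_mx specialize y) =
  map_mx specialize (table_mul univ_mul x y).
Proof. by rewrite map_table_mul. Qed.
Let actE' k x y :
  table_mul (spec_act k) (map_mx specialize x) (map_mx specialize y) =
  map_mx specialize (table_mul (univ_act k) x y).
Proof. by rewrite map_table_mul. Qed.

(* The arguments hn and f carry the multiplication table.                     *)
Definition spec_ring of (1 < n)%N & 'rV[int]_n.+1 : Type := 'rV[int]_n.
HB.instance Definition _ := GRing.Zmodule.on (spec_ring hn f).

Let mulA : associative (table_mul spec_mul).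
Proof.
move=> x y z; rewrite -[x]lftK -[y]lftK -[z]lftK !mulE'.
apply: (congr1 (map_mx specialize)).
exact: univ_mulA.
Qed.
Let mulC : commutative (table_mul spec_mul).
Proof.
move=> x y; rewrite !mulE.
apply: (congr1 (map_mx specialize)).
exact: univ_mulC.
Qed.
Let mul1 : left_id (row_one int n) (table_mul spec_mul).
Proof.
move=> x; rewrite -[x]lftK -(map_row_one n specialize) mulE'.
apply: (congr1 (map_mx specialize)).
exact: univ_mul1.
Qed.
Let one_neq0 : row_one int n != 0.
Proof. by apply/eqP => /rowP/(_ (Ordinal (ltnW hn))); rewrite !mxE. Qed.

HB.instance Definition _ := GRing.Zmodule_isComNzRing.Build (spec_ring hn f)
  mulA mulC mul1 (table_mulDl spec_mul) one_neq0.

Definition spec_pow of (1 < n)%N & 'rV[int]_n.+1 & nat : Type := 'rV[int]_n.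
HB.instance Definition _ k := GRing.Zmodule.on (spec_pow hn f k).

Let actA k (x y : spec_ring hn f) (z : spec_pow hn f k) :
  table_mul (spec_act k) x (table_mul (spec_act k) y z) =
  table_mul (spec_act k) (x * y) z.
Proof.
change (x * y) with (table_mul spec_mul x y).
rewrite -[x]lftK -[y]lftK -[z]lftK mulE' !actE'.
apply: (congr1 (map_mx specialize)).
exact: univ_actA.
Qed.
Let act1 k (z : spec_pow hn f k) : table_mul (spec_act k) (1 : spec_ring hn f) z = z.
Proof.
change (1 : spec_ring hn f) with (row_one int n).
rewrite -[z]lftK -(map_row_one n specialize) actE'.
apply: (congr1 (map_mx specialize)).
exact: univ_act1.
Qed.
HB.instance Definition _ k :=
  GRing.Zmodule_isLmodule.Build (spec_ring hn f) (spec_pow hn f k) (@actA k) (@act1 k)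
    (table_mulDr (spec_act k))
    (fun z a b => table_mulDl (spec_act k) a b z).
End Universal.

Definition modules_iso (R : comNzRingType) (M N : lmodType R) : Prop :=
  exists phi : {linear M -> N}, bijective phi.

(* Main.v *)
(** Let [tau] be the coordinate of [x] in [I_f^(n-2)] along the last vector
    [zeta_(n-1)] of the basis [1, theta, ..., theta^(n-2), zeta_(n-1)].  As
    [zeta_i] is [f_0 theta^i] plus lower terms, the matrix of
    [(r, x) |-> tau (r x)] in the bases of [R_f] and [I_f^(n-2)] vanishes above
    the antidiagonal and is [1] on it.  This pairing is thus perfect, and
    [x |-> (r |-> tau (r x))] is the isomorphism; the same entries of the
    universal tables specialize to any form, including [0]. *)

From HB Require Import structures.
Require Import Defs.
From mathcomp Require Import all_boot all_order all_algebra.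
From mathcomp Require Import perm boolp mpoly.

Set Implicit Arguments.
Unset Strict Implicit.
Unset Printing Implicit Defensive.

Import Order.TTheory GRing.Theory Num.Theory.
Local Open Scope ring_scope.

(** * Invertibility of antitriangular matrices *)

Lemma unitmx_antitriangular (R : comUnitRingType) (n : nat) (A : 'M[R]_n) :
  (forall i j : 'I_n, (i + j <= n.-1)%N -> A i j = (i + j == n.-1)%N%:R) ->
  A \in unitmx.
Proof.
(* Reversing the columns gives a lower triangular matrix with unit diagonal. *)
move=> hA; pose s := perm (@rev_ord_inj n).
have eA i j : col_perm s A i j = A i (rev_ord j) by rewrite mxE permE.
have := unitmx_mul A (perm_mx s^-1); rewrite unitmx_perm andbT => <-.
rewrite -col_permE unitmxE det_trig => [|].
  rewrite big1 ?unitr1 // => i _; rewrite eA hA /=;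
    have := ltn_ord i; case: (n) i => // m i hi; rewrite subSS subnKC ?eqxx //.
apply/is_trig_mxP => i j ij; rewrite eA hA /=;
  have := ltn_ord j; case: (n) i j ij => // m i j ij hj; rewrite subSS.
  rewrite ltn_eqF // -[X in (_ < X)%N](@subnKC j m) // ltn_add2r //.
by rewrite -[X in (_ <= X)%N](@subnKC j m) // leq_add2r ltnW.
Qed.

(** * Unimodular pairings and the inverse different *)

Section Pairing.
Variables (R : comNzRingType) (M : lmodType R) (n : nat).
Variables (e : 'I_n -> R) (b : 'I_n -> M) (tau : {additive M -> int}).

Lemma pairing_additive (m : M) :
  (fun s : R => tau (s *: m)) \in @additive_pred R.
Proof. by apply/asboolP => x y; rewrite scalerBl raddfB. Qed.

Definition pairing (m : M) : inv_different R :=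
  Sub (fun s : R => tau (s *: m)) (pairing_additive m).

Lemma pairing_is_linear : linear pairing.
Proof.
move=> r x y; apply: val_inj; apply: funext => s /=.
by rewrite [RHS]/GRing.add /= scalerDr raddfD scalerA mulrC.
Qed.
HB.instance Definition _ :=
  GRing.isLinear.Build R M (inv_different R) _ pairing pairing_is_linear.

Lemma inv_different_eq (p q : inv_different R) :
  (forall r, exists a : 'I_n -> int, r = \sum_i e i *~ a i) ->
  (forall i, \val p (e i) = \val q (e i)) -> p = q.
Proof.
move=> eP pq; apply: val_inj; apply: funext => r; have [a ->] := eP r.
pose add (u : inv_different R) := GRing.isZmodMorphism.Build R int (\val u)
  (asboolW (valP u)).
pose P : {additive R -> int} := HB.pack (\val p) (add p).
pose Q : {additive R -> int} := HB.pack (\val q) (add q).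
rewrite -[LHS]/(P _) -[RHS]/(Q _) !raddf_sum; apply: eq_bigr => i _.
by rewrite !raddfMz /= pq.
Qed.

(** In coordinates, [pairing] followed by evaluation at the [e i] is multiplication by the Gram
    matrix. Spanning families suffice: a relation among the [b j] would give a kernel vector of this
    invertible matrix. *)
Lemma unimodular_pairing_iso :
  (forall r, exists a : 'I_n -> int, r = \sum_i e i *~ a i) ->
  (forall m, exists w : 'I_n -> int, m = \sum_j b j *~ w j) ->
  \matrix_(i, j) tau (e i *: b j) \in unitmx ->
  modules_iso M (inv_different R).
Proof.
move=> eP bP; set G := matrix_of_fun _ _ => uG; exists pairing.
have pairE (w : 'cV_n) i :
    \val (pairing (\sum_j b j *~ w j 0)) (e i) = (G *m w) i 0.
  rewrite /= scaler_sumr raddf_sum mxE; apply: eq_bigr => j _.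
  by rewrite mxE -scalerMzr raddfMz mulrzz.
(* The preimage of [p] has the coordinates [w] that solve [G w = (p (e i))_i]. *)
exists (fun p : inv_different R =>
  \sum_j b j *~ (invmx G *m \col_i \val p (e i)) j 0).
- move=> m; have [w ->] := bP m.
  have -> : \sum_j b j *~ w j = \sum_j b j *~ (\col_j w j) j 0.
    by apply: eq_bigr => j _; rewrite mxE.
  apply: eq_bigr => j _; congr (_ *~ _ : M).
  rewrite -[\col_k w k in RHS](mulKmx uG).
  by congr ((_ *m _) _ _); apply/colP => i; rewrite mxE pairE.
- move=> p; apply: inv_different_eq => // i.
  by rewrite pairE mulKVmx // mxE.
Qed.
End Pairing.

(** * The last coordinate on products of basis vectors *)

Section InverseDifferentBasis.
Variables (D : idomainType) (K : fieldType) (iota : {rmorphism D -> K}).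
Variables (n : nat) (f : 'rV[D]_n.+1).
Hypotheses (hn : (1 < n)%N) (h0 : iota (f 0 0) != 0).

Local Notation Q := (Qalg iota f).
Local Notation theta := (theta iota f).
Local Notation zeta := (zeta iota f).
Local Notation powbasis := (powbasis iota f).

(** Horner recursion. It starts at [m = 1] because [zeta 0] is [1], not the empty sum. *)
Lemma zetaS m : (0 < m)%N ->
  theta * zeta m = zeta m.+1 - iota (fcoef f m) *: theta.
Proof.
case: m => // m _; rewrite [zeta m.+2]/Defs.zeta big_ord_recr /= subSnn expr1.
rewrite addrK mulr_sumr; apply: eq_bigr => i _.
by rewrite -scalerAr -exprS !subSn ?leqW ?leq_ord.
Qed.

Lemma zeta_n : zeta n = - (iota (fcoef f n) *: 1).
Proof.
apply/eqP; rewrite -addr_eq0 -(theta_root hn h0) big_ord_recr /= subnn expr0.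
rewrite -(fcoefE f ord_max) /=; apply/eqP; congr (_ + _).
case: (n) hn f => // m _ g; apply: eq_bigr => i _.
by rewrite -(fcoefE g (widen_ord _ i)).
Qed.

(* The coordinate along zeta_(n-1) in the basis 1, theta, ..., theta^(n-2),   *)
(* zeta_(n-1), as zeta_(n-1) has leading term f_0 theta^(n-1).                *)
Definition topcoef (x : Q) : K := (x : {poly K})`_n.-1 / iota (f 0 0).

Lemma topcoef_is_linear : scalar topcoef.
Proof.
move=> a x y; rewrite /topcoef.
have -> (u v : Q) : (u + v : {poly K}) = (u : {poly K}) + (v : {poly K}) by [].
by rewrite poly_of_qpolyZ coefD coefZ mulrDl mulrA.
Qed.
HB.instance Definition _ :=
  GRing.isLinear.Build K Q K _ topcoef topcoef_is_linear.

Lemma topcoef_theta l : (l < n)%N ->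
  topcoef (theta ^+ l) = (l == n.-1)%:R / iota (f 0 0).
Proof. by move=> ln; rewrite /topcoef val_theta // coefXn eq_sym. Qed.

(** Below degree [n] no reduction modulo the form occurs. Only the leading term [f_0 theta^(i+j)]
    can reach degree [n-1], and [topcoef] divides its [f_0] away. *)
Lemma topcoef_zeta_theta i j : (0 < i)%N -> (i + j < n)%N ->
  topcoef (zeta i * theta ^+ j) = (i + j == n.-1)%N%:R.
Proof.
case: i => // i _ ijn; rewrite mulr_suml linear_sum big_ord_recl big1 => [|t _].
  rewrite addr0 -scalerAl -exprD subn0 linearZ /= topcoef_theta //.
  by rewrite (fcoefE f ord0) mulrCA mulfV ?mulr1.
rewrite -scalerAl -exprD linearZ /= topcoef_theta /bump /= ?add1n ?subSS.
  rewrite ltn_eqF ?mul0r ?mulr0 //.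
  rewrite -ltnS prednK ?(ltnW hn) //; apply: leq_trans ijn.
  by rewrite !addSn !ltnS leq_add2r leq_subr.
by apply: leq_ltn_trans ijn; rewrite leq_add2r (leq_trans (leq_subr _ _)).
Qed.

(** The row [i = 0] is special, since [zeta_0 = 1] carries no factor [f_0]. There [theta^j] with
    [j <= n-2] stays below the top degree, and the last basis vector [zeta_(n-1)] supplies the
    [1]. *)
Lemma topcoef_pairing i j : (i + j <= n.-1)%N ->
  topcoef (zeta i * powbasis (n - 2) j) = (i + j == n.-1)%N%:R.
Proof.
move=> ij; have n0 : (0 < n)%N by apply: ltnW.
have ijn : (i + j < n)%N by rewrite -(prednK n0) ltnS.
rewrite /Defs.powbasis; case: leqP => [jn|nj].
  case: i ij ijn => [|i] ij ijn; last exact: topcoef_zeta_theta.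
  rewrite mul1r topcoef_theta // ltn_eqF ?mul0r //.
  by rewrite (leq_ltn_trans jn) // -subn1 ltn_sub2l.
have jE : j = n.-1.
  apply/eqP; rewrite eqn_leq (leq_trans (leq_addl _ _) ij) /=.
  by rewrite -subn1; move: nj; rewrite -subSn // subSS.
have i0 : i = 0%N by move: ij; rewrite -jE -{2}[j]add0n leq_add2r leqn0 => /eqP.
rewrite i0 mul1r add0n -[zeta j]mulr1 -[1](expr0 theta).
rewrite topcoef_zeta_theta ?addn0 // jE ?prednK // -subn1 ?subn_gt0 //.
Qed.

(** This is the row [i = 0] of the pairing, as [zeta_0 = 1]. Hence [topcoef] is [D]-valued on the
    span of the basis. *)
Lemma topcoef_comb (o : 'I_n) (a : 'rV[D]_n) : o = n.-1 :> nat ->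
  topcoef (comb (powbasis (n - 2)) a) = iota (a 0 o).
Proof.
move=> oE; have jn (j : 'I_n) : (j <= n.-1)%N.
  by rewrite -ltnS prednK // ltnW.
rewrite linear_sum (bigD1 o) //= big1 => [|j jo].
  rewrite addr0 linearZ /= -[X in topcoef X]mul1r (@topcoef_pairing 0);
    by rewrite ?add0n ?oE ?eqxx ?mulr1.
rewrite linearZ /= -[X in topcoef X]mul1r (@topcoef_pairing 0) ?add0n ?jn //.
by rewrite -oE val_eqE (negPf jo) mulr0.
Qed.

(** * Spans of the bases under multiplication by [R_f], [1] and [theta] *)

Definition span_powbasis (k : nat) (x : Q) := exists a, x = comb (powbasis k) a.

Lemma span0 k : span_powbasis k 0.
Proof. by exists 0; rewrite raddf0. Qed.

Lemma spanD k x y :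
  span_powbasis k x -> span_powbasis k y -> span_powbasis k (x + y).
Proof. by move=> [u ->] [v ->]; exists (u + v); rewrite raddfD. Qed.

Lemma spanZ k d x : span_powbasis k x -> span_powbasis k (iota d *: x).
Proof. by move=> [u ->]; exists (d *: u); rewrite combZ. Qed.

Lemma spanN k x : span_powbasis k x -> span_powbasis k (- x).
Proof. by move=> [u ->]; exists (- u); rewrite raddfN. Qed.

Lemma span_sum k (I : Type) (r : seq I) (F : I -> Q) :
  (forall i, span_powbasis k (F i)) -> span_powbasis k (\sum_(i <- r) F i).
Proof. by move=> hF; apply: big_ind => //; [exact: span0|exact: spanD]. Qed.

Lemma span_basis k j : (j < n)%N -> span_powbasis k (powbasis k j).
Proof. by move=> hj; exists (delta_mx 0 (Ordinal hj)); rewrite comb_delta. Qed.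

Lemma span_theta k j : (j <= k)%N -> (j < n)%N -> span_powbasis k (theta ^+ j).
Proof. by move=> jk jn; have := span_basis k jn; rewrite /Defs.powbasis jk. Qed.

(** The range includes [m = n] because [theta * zeta_(n-1)] produces [zeta_n], which is the constant
    [- f_n]. *)
Lemma span_zeta k m : (m <= n)%N -> span_powbasis k (zeta m).
Proof.
have n0 : (0 < n)%N by exact: ltnW.
rewrite leq_eqVlt => /orP[/eqP->|mn].
  by rewrite zeta_n; apply/spanN/spanZ/(@span_theta k 0).
have [km|mk] := ltnP k m.
  by have := span_basis k mn; rewrite /Defs.powbasis leqNgt km.
case: m mn mk => [|m] mn mk; first exact: (@span_theta k 0).
apply: span_sum => i; apply/spanZ/span_theta.
  exact: leq_trans (leq_subr _ _) mk.
exact: leq_ltn_trans (leq_subr _ _) mn.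
Qed.

Lemma span_zetaM k a x :
  span_powbasis k x -> span_powbasis k (comb zeta a * x).
Proof.
move=> [c ->]; rewrite mulr_suml; apply: span_sum => i.
rewrite mulr_sumr; apply: span_sum => j.
by rewrite -scalerAl -scalerAr; do 2!apply: spanZ; apply: zeta_powbasis.
Qed.

Lemma span_succ k x : span_powbasis k x -> span_powbasis k.+1 x.
Proof.
move=> [c ->]; apply: span_sum => j; apply: spanZ.
rewrite /Defs.powbasis; case: leqP => jk.
  by apply: span_theta => //; apply: leqW.
by apply: span_zeta; apply: ltnW.
Qed.

(** Together with [span_succ], this says that both generators [1] and [theta] of [I_f] map level [k]
    into level [k+1]. *)
Lemma span_thetaM k x : (k.+1 < n)%N ->
  span_powbasis k x -> span_powbasis k.+1 (theta * x).
Proof.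
move=> kn [c ->]; rewrite mulr_sumr; apply: span_sum => j.
rewrite -scalerAr; apply: spanZ; rewrite /Defs.powbasis; case: leqP => jk.
  by rewrite -exprS; apply: span_theta => //; apply: leq_ltn_trans kn.
rewrite zetaS ?(leq_ltn_trans _ jk) //; apply: spanD; first exact: span_zeta.
by apply/spanN/spanZ/(@span_theta k.+1 1).
Qed.

End InverseDifferentBasis.

(** * Integral forms with nonzero leading coefficient *)

Section NonzeroLead.
Variables (n : nat) (f : 'rV[int]_n.+1).
Hypotheses (hn : (1 < n)%N) (h0 : f 0 0 != 0).

Local Notation iota := (intr : {rmorphism int -> rat}).

(** Links the ideal power, defined by sums of products, to its explicit basis, by induction on
    [k]. *)
Lemma If_powE k (x : Qf f) : (k < n)%N ->
  x \in If_pow_pred f k <-> span_powbasis k x.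
Proof.
have h0' : iota (f 0 0) != 0 by rewrite intr_eq0.
have Rf1 : 1 \in Rf_pred f by apply/asboolP; apply: comb_zeta1.
have Rf0 : 0 \in Rf_pred f by apply/asboolP; exists 0; rewrite raddf0.
have If1 : 1 \in If_pred f.
  by apply/asboolP; exists 1, 0; split=> //; rewrite mul0r addr0.
elim: k x => [|k IHk] x kn.
  have e a : comb (zeta iota f) a = comb (powbasis iota f 0) a.
    by apply: eq_bigr => i _; rewrite powbasis0.
  by split=> [/asboolP[a ->]|[a ->]]; [exists a|apply/asboolP; exists a].
have {}IHk y := IHk y (ltnW kn); split.
  move=> /asboolP[s sP ->]; elim: s sP => [|[p q] s IHs] /=.
    by rewrite big_nil => _; apply: span0.
  case/andP=> /andP[/asboolP[r [t [/asboolP[a ->] /asboolP[c ->] ->]]]].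
  move=> /IHk qP sP; rewrite big_cons /=; apply: spanD; last exact: IHs.
  (* The product is [r q + t (theta q)]. Both [q] and [theta q] lie in level [k+1], which is stable
     under [r] and [t] in [R_f]. *)
  rewrite mulrDl -mulrA; apply: spanD; apply: span_zetaM => //.
    exact: span_succ.
  exact: span_thetaM.
move=> [a ->]; apply/asboolP.
(* Passing from [k] to [k+1] changes only the basis vector of index [k+1], now
   [theta^(k+1) = theta * theta^k]. The others already lie in level [k] and are multiplied by
   [1]. *)
exists [seq if (i == k.+1 :> nat)
             then (iota (a 0 i) *: theta iota f, theta iota f ^+ k)
             else (1, iota (a 0 i) *: powbasis iota f k.+1 i)
       | i : 'I_n <- enum 'I_n].
  rewrite all_map; apply/allP => i _ /=; case: eqP => [_|/eqP ik] /=.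
    apply/andP; split; last by apply/IHk/span_theta => //; apply: ltnW.
    apply/asboolP; exists 0, (iota (a 0 i) *: 1); split=> //.
      apply/asboolP; have [c ->] := comb_zeta1 iota f hn.
      by exists (a 0 i *: c); rewrite combZ.
    by rewrite add0r -scalerAl mul1r.
  rewrite If1; apply/IHk/spanZ.
  have -> : powbasis iota f k.+1 i = powbasis iota f k i.
    by rewrite /powbasis leq_eqVlt (negPf ik) ltnS.
  exact: span_basis.
rewrite big_map big_enum /=; apply: eq_bigr => i _.
case: eqP => [ik|_] /=; last by rewrite mul1r.
by rewrite -scalerAl -exprS /powbasis ik leqnn.
Qed.

Let n2_lt : (n - 2 < n)%N.
Proof. by rewrite ltn_subrL /= ltnW. Qed.

Lemma Rf_zeta_in (i : 'I_n) : zeta iota f i \in Rf_mem hn h0.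
Proof. by apply/asboolP; exists (delta_mx 0 i); rewrite comb_delta. Qed.

Lemma If_powbasis_in (i : 'I_n) :
  powbasis iota f (n - 2) i \in If_pow_mem hn h0 (n - 2).
Proof. by apply/(If_powE _ n2_lt)/span_basis. Qed.

(** Taking the numerator loses nothing: on [I_f^(n-2)] the rational number [topcoef] is an integer
    coordinate. *)
Definition If_pow_topcoef (x : If_pow hn h0 (n - 2)) : int :=
  numq (topcoef (\val x : Qf f)).

Lemma If_pow_topcoefE x :
  iota (If_pow_topcoef x) = topcoef (\val x : Qf f).
Proof.
have h0' : iota (f 0 0) != 0 by rewrite intr_eq0.
have on : (n.-1 < n)%N by rewrite prednK // ltnW.
rewrite /If_pow_topcoef; have /(If_powE _ n2_lt)[a ->] := valP x.
by rewrite (@topcoef_comb _ _ _ _ _ hn h0' (Ordinal on)) //= numq_int.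
Qed.

Lemma If_pow_topcoef_is_additive : zmod_morphism If_pow_topcoef.
Proof.
move=> x y; apply: (@intr_inj rat).
by rewrite rmorphB /= !If_pow_topcoefE !raddfB.
Qed.
HB.instance Definition _ := GRing.isZmodMorphism.Build _ _ If_pow_topcoef
  If_pow_topcoef_is_additive.

Lemma If_pow_iso :
  modules_iso (If_pow hn h0 (n - 2)) (inv_different (Rf hn h0)).
Proof.
have h0' : iota (f 0 0) != 0 by rewrite intr_eq0.
pose e (i : 'I_n) : Rf hn h0 := Sub (zeta iota f i) (Rf_zeta_in i).
pose b (i : 'I_n) : If_pow hn h0 (n - 2) :=
  Sub (powbasis iota f (n - 2) i) (If_powbasis_in i).
apply: (@unimodular_pairing_iso _ _ n e b If_pow_topcoef).
- move=> r; have /asboolP[a ra] := valP r; exists (a 0); apply: val_inj.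
  rewrite ra raddf_sum.
  by apply: eq_bigr => i _; rewrite raddfMz /= scaler_int.
- move=> r; have /(If_powE _ n2_lt)[a ra] := valP r; exists (a 0).
  apply: val_inj; rewrite ra raddf_sum.
  by apply: eq_bigr => i _; rewrite raddfMz /= scaler_int.
- apply: unitmx_antitriangular => i j ij; rewrite mxE; apply: (@intr_inj rat).
  by rewrite If_pow_topcoefE /= topcoef_pairing // rmorph_nat.
Qed.
End NonzeroLead.

(** * Universal tables and their specializations *)

Lemma table_mul_delta (D : comNzRingType) (n : nat) (t : 'I_n -> 'M[D]_n) i j :
  table_mul t (delta_mx 0 i) (delta_mx 0 j) = row j (t i).
Proof.
rewrite /table_mul (bigD1 i) //= big1 => [|l li].
  by rewrite addr0 mxE !eqxx scale1r rowE.
by rewrite mxE (negPf li) andbF scale0r.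
Qed.

(** The entry is the last coordinate of [zeta_i * b_j], with [b_j] the basis of the universal
    [I^(n-2)]. It is computed by [topcoef] in the fraction field, where the indeterminate [f_0] is
    invertible, and pulled back by injectivity. *)
Lemma univ_act_antitriangular (n : nat) (hn : (1 < n)%N) (o i j : 'I_n) :
  o = n.-1 :> nat -> (i + j <= n.-1)%N ->
  univ_act hn (n - 2) i j o = (i + j == n.-1)%N%:R.
Proof.
move=> oE ij.
pose iota : {rmorphism {mpoly int[n.+1]} -> {fraction {mpoly int[n.+1]}}} :=
  @tofrac _.
have h0 : iota (univ_form n 0 0) != 0.
  rewrite mxE tofrac_eq0; apply/eqP => /(congr1 (mcoeff U_(0))) /eqP.
  by rewrite mcoeffX eqxx mcoeff0.
apply/eqP; rewrite -tofrac_eq; apply/eqP.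
rewrite -[LHS]/(iota _) -[RHS]/(iota _) rmorph_nat.
rewrite -(topcoef_pairing hn h0 ij).
have := comb_univ_act hn (n - 2) (delta_mx 0 i) (delta_mx 0 j).
rewrite !comb_delta table_mul_delta => <-.
by rewrite (topcoef_comb hn h0 _ oE) [in RHS]mxE.
Qed.

Section Specialized.
Variables (n : nat) (hn : (1 < n)%N) (f : 'rV[int]_n.+1).

Definition spec_coord (o : 'I_n) (x : spec_pow hn f (n - 2)) : int :=
  (x : 'rV[int]_n) 0 o.

Lemma spec_coord_is_additive o : zmod_morphism (spec_coord o).
Proof. by move=> x y; rewrite /spec_coord !mxE. Qed.
HB.instance Definition _ o := GRing.isZmodMorphism.Build _ _ (spec_coord o)
  (spec_coord_is_additive o).

Lemma row_sum_deltaz (x : 'rV[int]_n) : x = \sum_i delta_mx 0 i *~ x 0 i.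
Proof.
by rewrite {1}[x]row_sum_delta; apply: eq_bigr => i _; rewrite -scaler_int intz.
Qed.

Lemma spec_pow_iso :
  modules_iso (spec_pow hn f (n - 2)) (inv_different (spec_ring hn f)).
Proof.
have on : (n.-1 < n)%N by rewrite prednK // ltnW.
pose o := Ordinal on.
pose e (i : 'I_n) : spec_ring hn f := delta_mx 0 i.
pose b (i : 'I_n) : spec_pow hn f (n - 2) := delta_mx 0 i.
apply: (@unimodular_pairing_iso _ _ n e b (spec_coord o)).
- by move=> r; exists ((r : 'rV[int]_n) 0); apply: row_sum_deltaz.
- by move=> m; exists ((m : 'rV[int]_n) 0); apply: row_sum_deltaz.
apply: unitmx_antitriangular => i j ij; rewrite mxE /= /spec_coord.
have -> : e i *: b j = row j (spec_act hn f (n - 2) i).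
  exact: table_mul_delta.
(* These universal entries are the constants [0] and [1], which every specialization fixes, even the
   one at the zero form. *)
by rewrite 2!mxE univ_act_antitriangular // rmorph_nat.
Qed.
End Specialized.

Theorem theorem2p4 (n : nat) (hn : (1 < n)%N) (f : 'rV[int]_n.+1) :
  [/\ forall h0 : f 0 0 != 0,
        modules_iso (If_pow hn h0 (n - 2)%N) (inv_different (Rf hn h0)),
      f != 0 -> f 0 0 = 0 ->
        forall g : 'M[int]_2, g \in unitmx ->
        forall h0 : form_subst g f 0 0 != 0,
          modules_iso (If_pow hn h0 (n - 2)%N) (inv_different (Rf hn h0))
    & f = 0 ->
        modules_iso (spec_pow hn f (n - 2)%N) (inv_different (spec_ring hn f))].
Proof.
(* The first two cases are one lemma, applied to [f] and to its transform [form_subst g f]; the zero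
   form goes through the tables. *)
split=> [h0|_ _ g _ h0|_]; [exact: If_pow_iso|exact: If_pow_iso|].
exact: spec_pow_iso.
Qed.
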